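(* Let $\mathcal{P}=\{\Pr(G): G\text{ a finite group}\}\subset(0,1]$ be the set of commuting probabilities of all finite groups. Then all limit points of $\mathcal{P}$ (in $\mathbf{R}$) are rational, and $\mathcal{P}$ is well ordered by $>$.
   Context: For a finite group $G$, the commuting probability is $\Pr(G)=\frac{1}{|G|^2}|\{(x,y)\in G^2: xy=yx\}|$. A set of real numbers is well ordered by $>$ if each of its nonempty subsets has a greatest element (equivalently, it contains no infinite strictly increasing sequence). *)

(* Defs.v *)
From mathcomp Require Import all_boot all_order all_algebra all_fingroup.
From mathcomp Require Import all_classical all_reals all_analysis.

Set Implicit Arguments.
Unset Strict Implicit.
Unset Printing Implicit Defensive.

Import Order.TTheory GRing.Theory Num.Theory.
Import numFieldNormedType.Exports.

Local Open Scope classical_set_scope.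
Local Open Scope ring_scope.

Definition comm_pairs (gT : finGroupType) (G : {group gT}) : {set gT * gT} :=
  [set u in finset.setX G G | (u.1 * u.2 == u.2 * u.1)%g]%SET.

Definition comm_prob (R : realType) (gT : finGroupType) (G : {group gT}) : R :=
  #|comm_pairs G|%:R / #|G|%:R ^+ 2.

Definition comm_probs (R : realType) : set R :=
  [set x | exists (gT : finGroupType) (G : {group gT}), x = comm_prob R G].
Arguments comm_probs : clear implicits.

Definition well_ordered_gt (R : realType) (S : set R) : Prop :=
  forall A : set R, A `<=` S -> A !=set0 -> exists m, A m /\ ubound A m.

(* Main.v *)
Require Import Defs.
From mathcomp Require Import all_boot all_order all_algebra all_fingroup.
From mathcomp Require Import all_solvable zify.

Set Implicit Arguments.
Unset Strict Implicit.
Unset Printing Implicit Defensive.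

(**
Let [Pr(G)] be bounded below.  By P. M. Neumann's theorem [G] has a normal
subgroup [K] of bounded index with [H = K'] central in [K] and of bounded order.
Count pairs with [[a, b] \in H].  For [a] and [b] in fixed cosets of [K] this is a
linear condition modulo [H], so the solutions form a coset of a subgroup of
[K * K] or the empty set: the proportion [q] of such pairs is a bounded sum of unit
fractions over a bounded denominator.  For fixed [a], each value of [[a, b]] is
taken [|'C(a)|] times, so [Pr(G) >= q / |H|], and the difference is only due to
elements [a] with [H] not contained in [[a, G]].  If these contribute
substantially, many of them have small classes, and comparing them within a coset
of [K] produces a normal subgroup [K1] of bounded index with [K1'] a proper
subgroup of [H].  Iterating, [Pr(G)] is the sum of a bounded Egyptian-type
fraction and of a nonnegative error, as small as wished in terms of the bound.
Finally, sums of [n] unit fractions never accumulate at an irrational number, nor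
at any number from below, and this passes to [Pr(G)].
*)

Local Open Scope group_scope.

(** * Indices and classes *)

Lemma leq_indexgI (gT : finGroupType) (G A B : {group gT}) :
  A \subset G -> #|G : A :&: B| <= #|G : A| * #|G : B|.
Proof.
move=> sAG; rewrite -(Lagrange_index sAG (subsetIl A B)) indexgI leq_mul2l.
by rewrite subset_leq_card ?orbT // imsetS.
Qed.

Lemma leq_index_astab (aT : finGroupType) (rT : finType)
    (to : {action aT &-> rT}) (G : {group aT}) (S : {set rT}) (n : nat) :
  (forall x, x \in S -> #|orbit to G x| <= n) ->
  #|G : 'C_G(S | to)| <= n ^ #|S|.
Proof.
elim: {S}_.+1 {-2}S (ltnSn #|S|) => // k IHk S leSk orbS.
have [->|[x Sx]] := set_0Vmem S.
  by rewrite cards0 (setIidPl _) ?indexgg // astabC sub0set.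
have defS := setD1K Sx; rewrite -{1}defS astabU.
rewrite -[in X in _ <= n ^ X]defS cardsU1 !inE eqxx expnS setIIr setIC.
apply: leq_trans (leq_indexgI _ _) _; first exact: subsetIl.
rewrite mulnC leq_mul //; first by rewrite -card_orbit orbS.
apply: IHk => [|y /setD1P[_ /orbS //]].
by move: leSk; rewrite (cardsD1 x) Sx.
Qed.

Lemma leq_index_cent (gT : finGroupType) (G : {group gT}) (T : {set gT}) n :
  (forall x, x \in T -> #|x ^: G| <= n) -> #|G : 'C_G(T)| <= n ^ #|T|.
Proof.
move=> clT; rewrite -astabJ; apply: leq_index_astab => x Tx.
by rewrite orbitJ clT.
Qed.

(** The core is the pointwise stabiliser of the cosets of [B] in [G] under right translation by
    [G]. *)
Lemma leq_index_gcore (gT : finGroupType) (G B : {group gT}) :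
  #|G : gcore B G| <= #|G : B| ^ #|G : B|.
Proof.
rewrite -astabRs_rcosets -[X in X <= _]indexgI.
have := @leq_index_astab _ _ 'Rs%act G (rcosets B G) #|G : B|.
apply=> x; case/rcosetsP=> a Ga ->; apply: subset_leq_card.
apply/subsetP=> _ /orbitP[b Gb <-]; rewrite /= rcosetE -rcosetM.
by apply/rcosetsP; exists (a * b); rewrite ?groupM.
Qed.

Lemma leq_index_cent1 (gT : finGroupType) (G K : {group gT}) (x : gT) :
  K \subset G -> #|K : 'C_K[x]| <= #|x ^: G|.
Proof. by move=> sKG; rewrite index_cent1 subset_leq_card ?imsetS. Qed.

Lemma leq_card_mulg (gT : finGroupType) (A B : {set gT}) :
  #|A * B| <= #|A| * #|B|.
Proof. by rewrite -cardsX [A * B]curry_imset2X leq_imset_card. Qed.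

Lemma leq_card_classM (gT : finGroupType) (G : {group gT}) (x y : gT) :
  #|(x * y) ^: G| <= #|x ^: G| * #|y ^: G|.
Proof.
apply: leq_trans (leq_card_mulg _ _); apply: subset_leq_card.
by apply/subsetP=> _ /imsetP[z Gz ->]; rewrite conjMg mem_mulg ?memJ_class.
Qed.

(** * Neumann's theorem *)

(** Elements with more than [2 d] conjugates contribute at most [|G| ^ 2 / (2 d)] to the sum, so the
    others contribute at least as much, each at most [|G|]. *)
Lemma card_small_class (gT : finGroupType) (G : {group gT}) (A : {set gT}) d :
  A \subset G -> #|G| ^ 2 <= d * \sum_(a in A) #|'C_G[a]| ->
  #|G| <= d.*2 * #|[set a in A | #|a ^: G| <= d.*2]|.
Proof.
move=> sAG leGd; set A' := [set a in A | _].
have leC a : a \in A -> d.*2 * #|'C_G[a]| <= (a \in A') * (d.*2 * #|G|) + #|G|.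
  move=> Aa; rewrite inE Aa /=; case: (leqP #|a ^: G| d.*2) => [_ | /ltnW le_d];
    rewrite /= ?mul1n.
    rewrite (leq_trans _ (leq_addr _ _)) // leq_mul2l.
    by rewrite subset_leq_card ?orbT ?subsetIl.
  rewrite mul0n add0n -(Lagrange (subsetIl G 'C[a])) index_cent1 mulnC.
  by rewrite leq_mul2l le_d orbT.
have leA' : \sum_(a in A) (a \in A') <= #|A'|.
  rewrite -sum1_card big_mkcond [leqRHS]big_mkcond leq_sum // => x _.
  by case: (x \in A) (x \in A') => [] [].
have leA : #|A| <= #|G| := subset_leq_card sAG.
have: (\sum_(a in A) d.*2 * #|'C_G[a]| <=
       \sum_(a in A) ((a \in A') * (d.*2 * #|G|) + #|G|))%N by apply: leq_sum.
rewrite -big_distrr big_split -big_distrl /=.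
rewrite sum_nat_const => le_sum; rewrite -(leq_pmul2l (cardG_gt0 G)).
have := leq_mul leA' (leqnn (d.*2 * #|G|)).
have := leq_mul leA (leqnn #|G|); rewrite -mulnn in leGd.
move: leGd le_sum; rewrite -!muln2; set x := bigop _ _ _.
set y := bigop _ _ _; set g := #|G|.
move: x y g #|A| #|A'| => x y g u v; nia.
Qed.

Lemma card_gen_abelian (gT : finGroupType) (T : {set gT}) n k :
  abelian <<T>> -> #|T| <= k -> {in T, forall x, x ^+ n = 1} -> 0 < n ->
  #|<<T>>| <= n ^ k.
Proof.
move=> cTT leTk Tn n_gt0.
have expT: exponent <<T>> %| n.
  have gE: group_set [set x in <<T>> | x ^+ n == 1].
    apply/group_setP; split=> [|x y]; first by rewrite inE group1 expg1n eqxx.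
    rewrite !inE => /andP[Tx /eqP xn] /andP[Ty /eqP yn]; rewrite groupM //=.
    by rewrite expgMn ?xn ?yn ?mulg1 //; apply: (centsP cTT).
  apply/exponentP=> x Tx; have: <<T>> \subset Group gE.
    by rewrite gen_subG; apply/subsetP=> y Ty; rewrite inE mem_gen //= Tn.
  by move/subsetP/(_ _ Tx); rewrite inE => /andP[_ /eqP].
apply: leq_trans (max_card_abelian cTT) _.
have leE := dvdn_leq n_gt0 expT.
apply: (@leq_trans (n ^ 'r(<<T>>))); last first.
  by rewrite leq_pexp2l // -grank_abelian // (leq_trans (grank_min _)).
by case: ('r(_)) => // r; rewrite leq_exp2r.
Qed.

(* If [a] has a class of maximal size and [u] centralises elements conjugating [a]
   to each of its conjugates, then [(u a)^K = u a^K]; hence all commutators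
   [[u, y]] lie in the small set [a^K (a^K)^-1]. *)
Lemma class2_of_bounded_classes (gT : finGroupType) (K : {group gT}) m :
  (forall x, x \in K -> #|x ^: K| <= m) ->
  exists U : {group gT}, [/\ U \subset K, #|K : U| <= m ^ m * m ^ (m * m),
    U^`(1) \subset 'Z(U) & #|U^`(1)| <= (m * m)`! ^ (m * m)].
Proof.
move=> leKm; case: (@arg_maxnP _ 1 [in K] (fun x => #|x ^: K|)) => // a Ka max_a.
have {max_a}maxa x : x \in K -> #|x ^: K| <= #|a ^: K| by apply: max_a.
have m_gt0: 0 < m.
  by apply: leq_trans (leKm _ Ka); apply/card_gt0P; exists a; apply: class_refl.
pose b z := odflt 1 [pick c in K | a ^ c == z].
have bP z : z \in a ^: K -> b z \in K /\ a ^ b z = z.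
  case/imsetP=> c Kc ->; rewrite /b; case: pickP => [x /andP[Kx /eqP] // | /(_ c)].
  by rewrite /= Kc eqxx.
pose B := b @: (a ^: K); pose U0 := 'C_K(B)%G.
have sBK: B \subset K by apply/subsetP=> _ /imsetP[z /bP[]] ? _ ->.
have leB: #|B| <= m by apply: leq_trans (leq_imset_card _ _) (leKm _ Ka).
have iU0: #|K : U0| <= m ^ m.
  apply: leq_trans (leq_pexp2l m_gt0 leB).
  by apply: leq_index_cent => x /(subsetP sBK) /leKm.
have sU0K : U0 \subset K := subsetIl _ _.
pose S := (a ^: K) * (a ^: K)^-1.
have leS: #|S| <= m * m.
  apply: leq_trans (leq_mul (leKm _ Ka) (leKm _ Ka)).
  by rewrite -[X in (_ * X)%N]card_invg leq_card_mulg.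
have saK: a ^: K \subset K by rewrite class_subG.
have sSK: S \subset K.
  rewrite mul_subG //; apply/subsetP=> x; rewrite mem_invg => /(subsetP saK).
  by rewrite groupV.
have commS u y : u \in U0 -> y \in K -> [~ u, y] \in S.
  case/setIP=> Ku cu Ky.
  have defua: u *: (a ^: K) = (u * a) ^: K.
    apply/eqP; rewrite eqEcard card_lcoset maxa ?groupM // andbT.
    apply/subsetP=> _ /lcosetP[z az ->]; have [Kb <-] := bP z az.
    suff {1}->: u = u ^ b z by rewrite -conjMg memJ_class.
    by apply/esym/conjg_fixP/commgP/(centP cu)/imset_f.
  have: (u * a) ^ y \in u *: (a ^: K) by rewrite defua memJ_class.
  rewrite mem_lcoset conjMg mulgA -/(commg u y) => Cy.
  by rewrite -(mulgK (a ^ y) [~ u, y]) mem_mulg // memV_invg memJ_class.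
(* Commutators of [U] lie in [S], so centralising [S] makes them central in [U]. *)
pose U := 'C_U0(S)%G.
have sUU0: U \subset U0 := subsetIl _ _.
have iU: #|U0 : U| <= m ^ (m * m).
  apply: leq_trans (leq_pexp2l m_gt0 leS); apply: leq_index_cent => x Sx.
  by apply: leq_trans (leKm _ (subsetP sSK _ Sx)); rewrite subset_leq_card ?imsetS.
have cUS: U \subset 'C(S) := subsetIr _ _.
pose T := commg_set U U.
have sTS: T \subset S.
  apply/subsetP=> _ /imset2P[x y Ux Uy ->]; rewrite commS ?(subsetP sUU0) //.
  by rewrite (subsetP sU0K) ?(subsetP sUU0).
have sTC: <<T>> \subset 'C(U) by rewrite gen_subG centsC (subset_trans cUS) ?centS.
have sTU: <<T>> \subset U.
  rewrite gen_subG; apply/subsetP=> _ /imset2P[x y Ux Uy ->].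
  exact: groupR.
exists U; rewrite derg1 /commutator -/T; split.
- exact: subset_trans sU0K.
- by rewrite -(Lagrange_index sU0K sUU0) leq_mul.
- by rewrite subsetI sTU.
apply: card_gen_abelian; last exact: fact_gt0.
- exact: subset_trans sTC (centS sTU).
- exact: leq_trans (subset_leq_card sTS) leS.
move=> _ /imset2P[x y Ux Uy ->].
(* [[x, y] ^ i = [x ^ i, y]]: the whole cyclic group lies in the small set [T], so the order of
   [[x, y]] divides [(m * m)!]. *)
have sxT: <[[~ x, y]]> \subset T.
  apply/subsetP=> _ /cycleP[i ->]; rewrite -commXg; last first.
    apply: commute_sym; apply: (centP (subsetP sTC _ _) _ Ux).
    by rewrite mem_gen // imset2_f.
  by rewrite imset2_f // groupX.
apply/eqP; rewrite -order_dvdn dvdn_fact // order_gt0 /=.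
exact: leq_trans (subset_leq_card (subset_trans sxT sTS)) leS.
Qed.

Definition small_class (gT : finGroupType) (G : {group gT}) (n : nat) : {set gT} :=
  [set a in G | #|a ^: G| <= n].

Lemma small_classS (gT : finGroupType) (G : {group gT}) m n :
  m <= n -> small_class G m \subset small_class G n.
Proof.
by move=> lemn; apply/subsetP=> a; rewrite !inE => /andP[-> /leq_trans->].
Qed.

Lemma small_classM (gT : finGroupType) (G : {group gT}) m n x y :
  x \in small_class G m -> y \in small_class G n ->
  x * y \in small_class G (m * n).
Proof.
rewrite !inE => /andP[Gx lex] /andP[Gy ley]; rewrite groupM //=.
by rewrite (leq_trans (leq_card_classM _ _ _)) ?leq_mul.
Qed.

Lemma small_classV (gT : finGroupType) (G : {group gT}) n x :
  (x^-1 \in small_class G n) = (x \in small_class G n).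
Proof. by rewrite !inE groupV classVg card_invg. Qed.

(** After a threshold [B] comes [(B e) ^ 2 e], which admits the product of an element with at most
    [(B e) ^ 2] conjugates and one with at most [e]. *)
Fixpoint growth_bound e k :=
  if k is k'.+1 then (growth_bound e k' * e * (growth_bound e k' * e) * e)%N else e.

(* If [y] has class size at most [m ^ 2] but not at most [m = n e], the translate
   [y *: small_class G e] is disjoint from [small_class G n]; by cardinality this
   can only happen for [e] successive values of [n]. *)
Lemma small_class_stable (gT : finGroupType) (G : {group gT}) e :
  0 < e -> #|G| <= e * #|small_class G e| ->
  exists2 m, e <= m <= growth_bound e e &
    small_class G (m * m) \subset small_class G m.
Proof.
move=> e_gt0 leGe; pose X := small_class G; pose B := growth_bound e.
have leB k : e <= B k.
  elim: k => // k IHk; rewrite /B /= -/(B k).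
  by rewrite leq_pmull // !muln_gt0 e_gt0 (leq_trans e_gt0 IHk).
have B_gt0 k : 0 < B k := leq_trans e_gt0 (leB k).
have leBS k : B k <= B k.+1.
  by rewrite /B /= -/(B k) -!mulnA leq_pmulr // !muln_gt0 e_gt0 B_gt0.
have dichotomy k : (exists2 m, e <= m <= B k & X (m * m)%N \subset X m) \/
    k.+1 * #|X e| <= #|X (B k)|.
  elim: k => [|k [[m /andP[lem lemB] sX] | leX]]; first by right; rewrite mul1n.
    by left; exists m; rewrite // lem (leq_trans lemB).
  pose m := (B k * e)%N.
  case: (boolP (X (m * m)%N \subset X m)) => [sX | /subsetPn[y Xy notXy]].
    left; exists m => //; have m_gt0: 0 < m by rewrite muln_gt0 B_gt0.
    by rewrite leq_pmull // /B /= -/(B k) -/m -mulnA leq_pmulr // muln_gt0 m_gt0.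
  right; have disj: [disjoint X (B k) & y *: X e].
    rewrite -setI_eq0; apply/set0Pn=> [[z /setIP[Xz]]]; rewrite mem_lcoset => Xyz.
    case/negP: notXy; have ->: y = z * (y^-1 * z)^-1 by rewrite invMg invgK mulKVg.
    by rewrite small_classM // small_classV.
  have sU: X (B k) :|: y *: X e \subset X (B k.+1).
    rewrite subUset small_classS //=; apply/subsetP=> _ /lcosetP[x Xx ->].
    exact: small_classM.
  apply: leq_trans (subset_leq_card sU).
  by rewrite cardsU (disjoint_setI0 disj) cards0 subn0 card_lcoset mulSn addnC
    leq_add2r.
(* At [k = e] the second alternative gives [(e + 1) |X e| <= |G| <= e |X e|], absurd for a nonempty
   [X e]. *)
have [// | leX] := dichotomy e.
have X_gt0: 0 < #|X e| by have := cardG_gt0 G; rewrite -/(X e) in leGe; nia.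
have: #|X (B e)| <= #|G|.
  by apply/subset_leq_card/subsetP=> x; rewrite inE => /andP[].
by rewrite -/(X e) in leGe; nia.
Qed.

(** Elements with small classes are dense; at a stable threshold they form a subgroup [X] of bounded
    index with bounded classes. It contains a subgroup of class at most 2 with small derived
    subgroup, and the normal core keeps these properties. *)
Lemma neumann_class2 e : exists M, forall (gT : finGroupType) (G : {group gT}),
  #|G| ^ 2 <= e * \sum_(a in G) #|'C_G[a]| ->
  exists K : {group gT}, [/\ K <| G, K^`(1) \subset 'Z(K), #|G : K| <= M
    & #|K^`(1)| <= M].
Proof.
pose m := growth_bound e.*2 e.*2.
pose i := (e.*2 * (m ^ m * m ^ (m * m)))%N.
exists (maxn (i ^ i) ((m * m)`! ^ (m * m))) => gT G leGe.
have leGX := card_small_class (subxx G) leGe; rewrite -/(small_class G _) in leGX.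
have e_gt0: 0 < e.*2 by have := cardG_gt0 G; nia.
have [n /andP[len lenm] sX] := small_class_stable e_gt0 leGX.
have gX: group_set (small_class G n).
  apply/group_setP; split=> [|x y Xx Xy].
    by rewrite inE group1 class1G cards1 (leq_trans _ len).
  exact: (subsetP sX) (small_classM Xx Xy).
pose X := Group gX; have sXG: X \subset G.
  by apply/subsetP=> x; rewrite inE => /andP[].
have iX: #|G : X| <= e.*2.
  have leX: #|small_class G e.*2| <= #|X| by apply/subset_leq_card/small_classS.
  rewrite -(leq_pmul2l (cardG_gt0 X)) Lagrange // mulnC.
  by rewrite (leq_trans leGX) // leq_mul2l leX orbT.
have cX x : x \in X -> #|x ^: X| <= m.
  rewrite inE => /andP[Gx lex]; apply: leq_trans lenm; apply: leq_trans lex.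
  by rewrite subset_leq_card ?imsetS.
have [U [sUX iU cU leU]] := class2_of_bounded_classes cX.
have sUG := subset_trans sUX sXG.
have iGU: #|G : U| <= i by rewrite -(Lagrange_index sXG sUX) leq_mul.
pose K := gcore U G; have sKU: K \subset U := gcore_sub U G.
have sdK: K^`(1) \subset U^`(1) by rewrite dergS.
exists K; split; first exact: gcore_normal.
- rewrite subsetI der_sub (subset_trans sdK) // (subset_trans cU) //.
  by rewrite (subset_trans (subsetIr _ _)) ?centS.
- apply: leq_trans (leq_index_gcore _ _) _; rewrite leq_max.
  have i_gt0 : 0 < i by apply: leq_trans iGU; apply: indexg_gt0.
  by rewrite (leq_trans (leq_pexp2l _ iGU)) ?leq_exp2r ?indexg_gt0.
- by rewrite leq_max (leq_trans (subset_leq_card sdK) leU) orbT.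
Qed.

(** * Commutators with values in the derived subgroup *)

Definition comm_values (gT : finGroupType) (x : gT) (A : {set gT}) : {set gT} :=
  [set [~ x, y] | y in A].

(** Commutators in [K] are central, so [y |-> [x, y]] is a homomorphism on [K]. *)
Lemma comm_values_group_set (gT : finGroupType) (K D : {group gT}) (x : gT) :
  K^`(1) \subset 'Z(K) -> x \in K -> D \subset K -> group_set (comm_values x D).
Proof.
move=> cK Kx sDK; apply/group_setP; split=> [|_ _ /imsetP[y Dy ->] /imsetP[z Dz ->]].
  by apply/imsetP; exists 1; rewrite ?comm1g ?commg1.
apply/imsetP; exists (z * y); rewrite ?groupM // commgMJ; congr (_ * _).
have /(subsetP cK)/setIP[_ /centP cz] : [~ x, z] \in K^`(1).
  by rewrite derg1 mem_commg // (subsetP sDK).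
by rewrite /conjg cz ?mulKg // (subsetP sDK).
Qed.

Lemma comm_bounded_group_set (gT : finGroupType) (K D L : {group gT}) :
  K^`(1) \subset 'Z(K) -> D \subset K ->
  group_set [set x in K | comm_values x D \subset L].
Proof.
move=> cK sDK; apply/group_setP; split=> [|x y].
  rewrite inE group1 /=; apply/subsetP=> _ /imsetP[y _ ->].
  by rewrite comm1g group1.
rewrite !inE => /andP[Kx sx] /andP[Ky sy]; rewrite groupM //=.
apply/subsetP=> _ /imsetP[z Dz ->]; rewrite commMgJ.
have /(subsetP cK)/setIP[_ /centP cz] : [~ x, z] \in K^`(1).
  by rewrite derg1 mem_commg // (subsetP sDK).
rewrite {1}/conjg cz // mulKg groupM //; first by rewrite (subsetP sx) ?imset_f.
by rewrite (subsetP sy) ?imset_f.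
Qed.

Lemma card_comm_fibre (gT : finGroupType) (G : {group gT}) (a c : gT) :
  a \in G ->
  #|[set b in G | [~ a, b] == c]| = ((c \in comm_values a G) * #|'C_G[a]|)%N.
Proof.
move=> Ga; case: imsetP => [[b0 Gb0 ->] | noc]; last first.
  rewrite mul0n; apply: eq_card0 => b; rewrite !inE; apply/andP=> -[Gb /eqP cE].
  by case: noc; exists b.
rewrite mul1n -[RHS](card_rcoset _ b0); apply: eq_card => b.
rewrite mem_rcoset in_setI [LHS]inE groupMr ?groupV //; case: (b \in G) => //=.
rewrite cent1C (inj_eq (mulgI _)) -(inj_eq (conjg_inj b0^-1)) conjgK -conjgM.
by apply/eqP/cent1P=> [/conjg_fixP/commgP | /commgP/conjg_fixP] //.
Qed.

Lemma card_comm_in (gT : finGroupType) (G : {group gT}) (H : {set gT}) (a : gT) :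
  a \in G ->
  #|[set b in G | [~ a, b] \in H]| = (#|H :&: comm_values a G| * #|'C_G[a]|)%N.
Proof.
move=> Ga; rewrite -sum1_card (partition_big (fun b => [~ a, b]) (mem H)) /=;
  last by move=> b; rewrite inE => /andP[].
rewrite (eq_bigr (fun c => (c \in comm_values a G) * #|'C_G[a]|))%N => [|c Hc].
  rewrite -big_distrl /=; congr (_ * _)%N; rewrite -sum1_card big_mkcond.
  by rewrite [RHS]big_mkcond; apply: eq_bigr => c _; rewrite !inE;
    do 2!case: (c \in _).
rewrite -card_comm_fibre // -sum1_card; apply: eq_bigl => b; rewrite !inE.
by case: eqP => [->|]; rewrite ?andbF ?andbT ?Hc ?andbT.
Qed.

Definition comm_in_count (gT : finGroupType) (G : {group gT}) (H : {set gT}) :=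
  \sum_(a in G) #|[set b in G | [~ a, b] \in H]|.

Lemma comm_in_count1 (gT : finGroupType) (G : {group gT}) :
  comm_in_count G 1 = \sum_(a in G) #|'C_G[a]|.
Proof.
apply: eq_bigr => a Ga; rewrite card_comm_in // (setIidPl _) ?cards1 ?mul1n //.
by rewrite sub1set; apply/imsetP; exists 1; rewrite ?commg1.
Qed.

(** * Descent to a smaller derived subgroup *)

(** [j] bounds the index of the subgroup found in the descent: its factors come from [K], from a
    pigeonhole over subgroups of [K'] and from a centraliser. The power [j ^ j] pays for the normal
    core. *)
Definition descent_bound (d h i : nat) : nat :=
  let j := (i * (d.*2 * 2 ^ h * d.*2))%N in j ^ j.

(** Averaged over [a] in [G], the set counted has [|K| |A| / |G| >= |K| / d] elements. Replacing [a]
    by some [a x0] in [A] only translates this set within [K]. *)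
Lemma exists_dense_translate (gT : finGroupType) (G K : {group gT})
    (A : {set gT}) d :
  K \subset G -> A \subset G -> #|G| <= d * #|A| ->
  exists2 a, a \in A & #|K| <= d * #|[set x in K | (a * x)%g \in A]|.
Proof.
move=> sKG sAG leGA.
have [a Ga leKa]: exists2 a, a \in G & #|K| <= d * #|[set x in K | (a * x)%g \in A]|.
  apply/exists_inP; apply/contraLR: isT => /exists_inPn ltK.
  have sumX: \sum_(a in G) #|[set x in K | (a * x)%g \in A]| = (#|K| * #|A|)%N.
    under eq_bigr do rewrite -sum1dep_card big_mkcondr /=.
    rewrite exchange_big -sum_nat_const /=; apply: eq_bigr => x Kx.
    rewrite -(card_rcoset A x^-1) -sum1_card [RHS]big_mkcond [LHS]big_mkcond /=.
    apply: eq_bigr => a _; rewrite mem_rcoset invgK.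
    case Aax: (a * x \in A); last by case: ifP.
    by rewrite -(groupMr _ (subsetP sKG x Kx)) (subsetP sAG _ Aax).
  have: \sum_(a in G) (d * #|[set x in K | (a * x)%g \in A]|).+1 <=
      \sum_(a in G) #|K|.
    by apply: leq_sum => a /ltK; rewrite -ltnNge.
  rewrite sum_nat_const (eq_bigr _ (fun a _ => esym (addn1 _))) big_split /=.
  rewrite -big_distrr sumX sum_nat_const /=.
  move: leGA (cardG_gt0 G) (cardG_gt0 K); move: #|G| #|K| #|A| => g k n; nia.
have /card_gt0P[x0]: 0 < #|[set x in K | (a * x)%g \in A]|.
  by move: leKa (cardG_gt0 K); case: #|[set x in K | _]|;
    rewrite ?muln0 //; case: #|K|.
rewrite inE => /andP[Kx0 Aax0]; exists (a * x0) => //.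
rewrite (leq_trans leKa) // leq_mul2l -(card_lcoset _ x0^-1).
rewrite subset_leq_card ?orbT //; apply/subsetP=> x.
by rewrite mem_lcoset invgK !inE groupMl // mulgA.
Qed.

(* If the commutators with [G] of many elements with a small class miss part of
   [K'], the differences of such elements in a coset of [K] commute with a large
   subgroup modulo a proper subgroup of [K']. *)
Lemma derived_descent (gT : finGroupType) (G K : {group gT}) d :
  K <| G -> K^`(1) \subset 'Z(K) ->
  d * (#|K^`(1)| * comm_in_count G 1) <=
    d * comm_in_count G K^`(1) + #|K^`(1)| * #|G| ^ 2 \/
  exists K1 : {group gT}, [/\ K1 <| G, K1^`(1) \subset 'Z(K1),
    #|K1^`(1)| < #|K^`(1)| &
    #|G : K1| <= descent_bound d #|K^`(1)| #|G : K|].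
Proof.
move=> nKG cK; have sKG := normal_sub nKG; set H := K^`(1)%G.
pose A := [set a in G | ~~ (H \subset comm_values a G)].
have sAG: A \subset G by apply/subsetP=> a; rewrite inE => /andP[].
(* For [a] outside [A], every value in [H] is attained, each [#|'C_G[a]|] times, so both counts
   agree. *)
have leN: #|H| * comm_in_count G 1 <=
    comm_in_count G H + #|H| * \sum_(a in A) #|'C_G[a]|.
  rewrite comm_in_count1 !big_distrr /= [X in _ <= _ + X]big_mkcond.
  rewrite [X in X <= _]big_mkcond [X in _ <= X + _]big_mkcond -big_split /=.
  apply: leq_sum => a _; rewrite inE; case: ifP => // Ga; rewrite card_comm_in //.
  by case: (boolP (H \subset _)) => [/setIidPl->|_]; rewrite ?leq_addr ?leq_addl.
have [leA | /ltnW leA] := leqP (d * \sum_(a in A) #|'C_G[a]|) (#|G| ^ 2).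
  left; move: leN leA; move: (comm_in_count _ _) (comm_in_count _ _) => x y.
  by move: (\sum_(a in A) _) (_ ^ 2)%N #|H| => u v h; nia.
right; have leGA := card_small_class sAG leA.
set A' := [set a in A | _] in leGA; have sA'A: A' \subset A.
  by apply/subsetP=> a; rewrite inE => /andP[].
have [a A'a] := exists_dense_translate sKG (subset_trans sA'A sAG) leGA.
set Y := [set x in K | _] => leKY.
have [Aa cla] : a \in A /\ #|a ^: G| <= d.*2 by move: A'a; rewrite inE => /andP[].
have Ga := subsetP sAG a Aa.
pose D := 'C_K[a]%G; have sDK : D \subset K := subsetIl _ _.
pose B L := Group (@comm_bounded_group_set _ K D L cK sDK).
(* [D] centralises [a], so [[a x, y] = [x, y]] for [y] in [D]: the group [[x, D]] lies among the
   values of [a x], which miss part of [H]. *)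
have YB x : x \in Y -> exists2 L : {group gT}, L \proper H & x \in B L.
  rewrite inE => /andP[Kx A'ax].
  exists (Group (comm_values_group_set cK Kx sDK)); last by rewrite inE Kx /=.
  rewrite properE; apply/andP; split.
    apply/subsetP=> _ /imsetP[y Dy ->]; rewrite /= derg1 mem_commg //.
    exact: (subsetP sDK).
  have : a * x \in A by apply: (subsetP sA'A).
  rewrite inE => /andP[_]; apply: contra => /subset_trans-> //=.
  apply/subsetP=> _ /imsetP[y Dy ->]; apply/imsetP; exists y.
    by rewrite (subsetP sKG) ?(subsetP sDK).
  rewrite commMgJ; suff ->: [~ a, y] = 1 by rewrite conj1g mul1g.
  by apply/eqP/commgP/commute_sym; case/setIP: Dy => _ /cent1P.
pose P := [set L : {group gT} | L \proper H].
(* Pigeonhole: the subgroups [B L] cover [Y], and there are at most [2 ^ |H|] choices of [L]. *)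
have [L PL leKB]: exists2 L, L \in P & #|K| <= d.*2 * 2 ^ #|H| * #|B L|.
  have sY: #|Y| <= \sum_(L in P) #|B L|.
    rewrite -sum1_card; under [leqRHS]eq_bigr do rewrite -sum1_card big_mkcond /=.
    rewrite exchange_big [leqLHS]big_mkcond /=; apply: leq_sum => x _.
    case: ifP => // /YB[L pL BLx]; rewrite (bigD1 L) ?inE //= in BLx *.
    by rewrite BLx.
  have leP: #|P| <= 2 ^ #|H|.
    rewrite -card_powerset -(card_imset _ (@val_inj _ _ _)).
    apply/subset_leq_card/subsetP=> X /imsetP[L PL ->]; rewrite inE in PL.
    by rewrite inE proper_sub.
  apply/exists_inP; apply/contraLR: isT => /exists_inPn ltK.
  have: \sum_(L in P) (d.*2 * 2 ^ #|H| * #|B L|).+1 <= \sum_(L in P) #|K|.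
    by apply: leq_sum => L /ltK; rewrite -ltnNge.
  rewrite (eq_bigr _ (fun a _ => esym (addn1 _))) big_split /= -big_distrr.
  rewrite !sum_nat_const muln1 /=.
  have: 0 < 2 ^ #|H| by rewrite expn_gt0.
  move: leKY leP sY (cardG_gt0 K).
  move: (2 ^ #|H|)%N (\sum_(_ in P) _) #|P| #|K| #|Y| => h s p k y.
  move: d.*2 => d2 leKY leP sY k_gt0 h_gt0 le1.
  have : h * k <= h * (d2 * s).
    by rewrite leq_mul2l (leq_trans leKY) ?orbT // leq_mul2l sY orbT.
  have := leq_mul leP (leqnn k); have : 0 < h * k by rewrite muln_gt0 h_gt0.
  case: p le1 {leP} => [|p] => le1; lia.
rewrite inE in PL.
(* For [x] and [y] in [C], [x] lies in [B L] and [y] in [D], so [[x, y]] lies in [L]. *)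
pose C := (B L :&: D)%G; pose K1 := gcore C G.
have sCK : C \subset K by rewrite (subset_trans (subsetIr _ _)).
have sCG := subset_trans sCK sKG.
have sK1C : K1 \subset C := gcore_sub C G.
have sK1K := subset_trans sK1C sCK.
have sK1L: K1^`(1) \subset L.
  rewrite derg1 gen_subG; apply/subsetP=> _ /imset2P[x y K1x K1y ->].
  have /setIP[Bx _] := subsetP sK1C x K1x; have /setIP[_ Dy] := subsetP sK1C y K1y.
  by move: Bx; rewrite inE => /andP[_ /subsetP->] //; apply: imset_f.
exists [group of K1]; split; first exact: gcore_normal.
- rewrite subsetI der_sub (subset_trans (dergS 1 sK1K)) // (subset_trans cK) //.
  by rewrite (subset_trans (subsetIr _ _)) ?centS.
- exact: leq_ltn_trans (subset_leq_card sK1L) (proper_card PL).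
have sBK : B L \subset K by apply/subsetP=> x; rewrite inE => /andP[].
have iB : #|K : B L| <= d.*2 * 2 ^ #|H|.
  by rewrite -(leq_pmul2l (cardG_gt0 (B L))) Lagrange // mulnC.
have iD : #|K : D| <= d.*2 := leq_trans (leq_index_cent1 _ sKG) cla.
have iC : #|G : C| <= #|G : K| * (d.*2 * 2 ^ #|H| * d.*2).
  rewrite -(Lagrange_index sKG sCK) leq_mul2l.
  by rewrite (leq_trans (leq_indexgI _ sBK)) ?leq_mul ?orbT.
apply: leq_trans (leq_index_gcore _ _) _; rewrite /descent_bound.
have i_gt0 := leq_trans (indexg_gt0 G C) iC.
by rewrite (leq_trans (leq_pexp2l _ iC)) ?leq_exp2r ?indexg_gt0.
Qed.

(** Induction on the bound [h] for [|K'|]: each descent makes [K'] smaller at the cost of a larger,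
    still bounded index. The tolerance [d] is consulted anew at each stage, so it may depend on the
    order and index finally reached. *)
Lemma exists_equidistributed (d : nat -> nat -> nat) h i :
  exists M, forall (gT : finGroupType) (G K : {group gT}),
    K <| G -> K^`(1) \subset 'Z(K) -> #|K^`(1)| <= h -> #|G : K| <= i ->
  exists K1 : {group gT}, let h1 := #|K1^`(1)| in let i1 := #|G : K1| in
    [/\ K1 <| G, h1 <= M, i1 <= M &
        d h1 i1 * (h1 * comm_in_count G 1) <=
          d h1 i1 * comm_in_count G K1^`(1) + h1 * #|G| ^ 2].
Proof.
elim: h i => [|h IHh] i.
  by exists 0 => gT G K _ _; rewrite leqNgt cardG_gt0.
pose F := \max_(h1 < h.+2) \max_(i1 < i.+1) descent_bound (d h1 i1) h1 i1.
have [M MP] := IHh F; exists (maxn M (maxn h.+1 i)) => gT G K nKG cK leh lei.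
have [done|[K1 [nK1 cK1 ltK1 iK1]]] := derived_descent (d #|K^`(1)| #|G : K|) nKG cK.
  by exists K; rewrite /= !leq_max leh lei !orbT.
have iF : #|G : K1| <= F.
  apply: leq_trans iK1 _; have ltK: #|K^`(1)| < h.+2 by [].
  have ltG: #|G : K| < i.+1 by [].
  apply: leq_trans (leq_bigmax (Ordinal ltK)).
  exact: (leq_bigmax (Ordinal ltG)).
have [|K2 /= [nK2 h2 i2 eqK2]] := MP gT G K1 nK1 cK1 _ iF.
  by rewrite -ltnS (leq_trans ltK1).
by exists K2; rewrite /= !leq_max h2 i2.
Qed.

(** * Counting pairs coset by coset *)

(** This turns commutation of [x a] and [y b] into an equation that is linear once [x] and [y] range
    over an abelian normal subgroup. *)
Lemma commute_coset_mul (gT : finGroupType) (a b x y : gT) :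
  commute a b ->
  (x * a * (y * b) == y * b * (x * a)) = (x * y ^ a^-1 == y * x ^ b^-1).
Proof.
move=> cab; rewrite -(inj_eq (mulIg (a * b)) (x * _)) {2}cab.
by rewrite /conjg !invgK !mulgA !mulgKV.
Qed.

(** Modulo [K'] the group [K] is abelian, so around one solution [(a, b)] the condition on
    [(x a, y b)] is linear in [x] and [y]. The pairs [(x, y)] form a subgroup of [K * K], and
    Lagrange's theorem applies. *)
Lemma card_coset_comm_in (gT : finGroupType) (G K : {group gT}) (C D : {set gT}) :
  K <| G -> C \in rcosets K G -> D \in rcosets K G ->
  let n := #|[set u in setX C D | [~ u.1, u.2] \in K^`(1)]| in
  n = 0%N \/ n %| #|K| ^ 2.
Proof.
move=> nKG RC RD n; rewrite {}/n; set F := [set u in _ | _].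
have [->|[[a b]]] := set_0Vmem F; first by left; rewrite cards0.
rewrite !inE /= => /andP[/andP[Ca Db] Hab]; right.
have defC : C = K :* a by case/rcosetsP: RC Ca => c _ -> /rcoset_eqP.
have defD : D = K :* b by case/rcosetsP: RD Db => c _ -> /rcoset_eqP.
have sKG := normal_sub nKG; set H := K^`(1)%G in F Hab *.
have nHG : G \subset 'N(H).
  by rewrite normal_norm // (char_normal_trans (der_char 1 K)).
have Ga: a \in G.
  case/rcosetsP: RC Ca => c Gc -> /rcosetP[k Kk ->].
  by rewrite groupM // (subsetP sKG).
have Gb: b \in G.
  case/rcosetsP: RD Db => c Gc -> /rcosetP[k Kk ->].
  by rewrite groupM // (subsetP sKG).
have commE u v : u \in G -> v \in G ->
    ([~ u, v] \in H) = (coset H u * coset H v == coset H v * coset H u).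
  move=> Gu Gv; have [nu nv] := (subsetP nHG u Gu, subsetP nHG v Gv).
  rewrite -[RHS](sameP commgP eqP) -morphR //; apply/idP/eqP; first exact: coset_id.
  by apply: coset_idr; rewrite groupR.
have cKK : abelian (K / H) by apply: sub_der1_abelian.
pose p x y := coset H x * coset H y ^ (coset H a)^-1.
pose q x y := coset H y * coset H x ^ (coset H b)^-1.
have nab c x : c \in G -> x \in K -> coset H x ^ (coset H c)^-1 \in K / H.
  move=> Gc Kx; rewrite memJ_norm ?mem_quotient //.
  by rewrite groupV (subsetP (quotient_norms H (normal_norm nKG))) ?mem_quotient.
have gW : group_set [set w in setX K K | p w.1 w.2 == q w.1 w.2].
  apply/group_setP; split=> [|[x y] [x' y']].
    by rewrite !inE !group1 /p /q /= !morph1 !conj1g !mulg1 /=.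
  rewrite !inE /= => /andP[/andP[Kx Ky] /eqP e] /andP[/andP[Kx' Ky'] /eqP e'].
  have nHK z : z \in K -> z \in 'N(H).
    by move=> Kz; rewrite (subsetP nHG) ?(subsetP sKG).
  rewrite !groupM //= /p /q !morphM ?nHK // !conjMg.
  have ACA z1 z2 z3 z4 : z2 \in K / H -> z3 \in K / H ->
      z1 * z2 * (z3 * z4) = z1 * z3 * (z2 * z4).
    by move=> A2 A3; rewrite -!mulgA (mulgA z2) (centsP cKK z2 A2 z3 A3) !mulgA.
  rewrite /p /q in e e'; rewrite ACA ?nab ?mem_quotient // e e'.
  by rewrite ACA ?nab ?mem_quotient.
have -> : #|F| = #|Group gW|.
  rewrite -[RHS](card_rcoset _ (a, b)); apply: eq_card => -[u v].
  rewrite mem_rcoset !inE /= defC defD !mem_rcoset.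
  case: (boolP ((u * a^-1 \in K) && (v * b^-1 \in K))) => [/andP[Ku Kv]|_] //=.
  have [Gu Gv] : u \in G /\ v \in G.
    rewrite -(groupMr u (groupVr Ga)) -(groupMr v (groupVr Gb)).
    by rewrite !(subsetP sKG).
  have defM w c : w \in G -> c \in G -> coset H w = coset H (w * c^-1) * coset H c.
    by move=> Gw Gc; rewrite -morphM ?mulgKV ?(subsetP nHG) ?groupMr ?groupV.
  rewrite [LHS]commE // (defM u a) // (defM v b) // commute_coset_mul //.
  by apply/eqP; rewrite -commE.
rewrite -mulnn -cardsX; apply: cardSg; apply/subsetP=> w.
by rewrite inE => /andP[].
Qed.

Lemma comm_in_countE (gT : finGroupType) (G : {group gT}) (H : {set gT}) :
  comm_in_count G H = #|[set u in setX G G | [~ u.1, u.2] \in H]|.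
Proof.
rewrite /comm_in_count; under eq_bigr do rewrite -sum1dep_card.
rewrite pair_big_dep -sum1_card; apply: eq_bigl => -[a b].
by rewrite !inE andbA.
Qed.

Lemma comm_in_count_cosets (gT : finGroupType) (G K : {group gT}) :
  K <| G -> exists s : seq nat, [/\ size s = (#|G : K| ^ 2)%N,
    {in s, forall n, n = 0%N \/ n %| #|K| ^ 2} &
    comm_in_count G K^`(1) = \sum_(n <- s) n].
Proof.
move=> nKG; have sKG := normal_sub nKG.
pose f (p : {set gT} * {set gT}) :=
  #|[set u in setX p.1 p.2 | [~ u.1, u.2] \in K^`(1)]|.
exists [seq f p | p <- enum (setX (rcosets K G) (rcosets K G))]; split.
- by rewrite size_map -cardE cardsX mulnn.
- move=> n /mapP[[C D]]; rewrite mem_enum inE => /andP[RC RD] ->.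
  exact: card_coset_comm_in nKG RC RD.
rewrite big_map big_enum comm_in_countE -sum1_card.
rewrite (partition_big (fun u => (K :* u.1, K :* u.2))
  [in setX (rcosets K G) (rcosets K G)]) => [|[a b]] /=; last first.
  by rewrite !inE /= => /andP[/andP[Ga Gb] _]; rewrite -!rcosetE !imset_f.
apply: eq_bigr => -[C D]; rewrite inE => /andP[RC RD].
rewrite /f -sum1_card; apply: eq_bigl => -[a b]; rewrite !inE xpair_eqE /=.
have memR E c : E \in rcosets K G -> (c \in E) = (c \in G) && (K :* c == E).
  case/rcosetsP=> g Gg ->; apply/idP/andP=> [cE | [Gc /eqP<-]];
    last exact: rcoset_refl.
  split; last by apply/eqP/rcoset_eqP.
  by apply: (subsetP _ _ cE); rewrite mul_subG ?sub1set.
rewrite (memR C) // (memR D) //.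
case: (a \in G); case: (b \in G); case: (_ == C); case: (_ == D) => //=.
all: by rewrite ?andbT ?andbF.
Qed.

Local Close Scope group_scope.

From mathcomp Require Import lra.
From mathcomp Require Import all_classical all_reals all_analysis.

Import Order.TTheory GRing.Theory Num.Theory.
Import numFieldNormedType.Exports.

Local Open Scope classical_set_scope.
Local Open Scope ring_scope.

(** * Sums of unit fractions *)

(* The junk value [0^-1 = 0] makes [0] a term, so fewer than [n] unit fractions
   are also covered. *)
Definition egyptian {R : realType} (n : nat) : set R :=
  [set x | exists s : seq nat, size s = n /\ x = \sum_(k <- s) k%:R^-1].

Lemma egyptian_ge0 {R : realType} n (x : R) : egyptian n x -> 0 <= x.
Proof. by case=> s [_ ->]; apply: sumr_ge0 => k _; rewrite invr_ge0 ler0n. Qed.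

Lemma rationalDr {R : realType} (x : R) (k : nat) :
  rational (x - k%:R^-1) -> rational x.
Proof.
case=> q _ eq_q; exists (q + k%:R^-1) => //.
by rewrite rmorphD /= [ratr k%:R^-1]fmorphV /= ratr_nat eq_q subrK.
Qed.

Lemma rational_mulr_nat {R : realType} (x : R) (k : nat) :
  (0 < k)%N -> rational (x * k%:R) -> rational x.
Proof.
move=> k_gt0 [q _ eq_q]; exists (q / k%:R) => //.
by rewrite rmorphM /= [ratr k%:R^-1]fmorphV /= ratr_nat eq_q mulfK //
  pnatr_eq0 -lt0n.
Qed.

Lemma exists_lower_bound {R : realType} (f : nat -> R) N :
  (forall k, 0 < f k) -> exists2 e : R, 0 < e & forall k, (k <= N)%N -> e <= f k.
Proof.
move=> f_gt0; elim: N => [|N [e e_gt0 eP]].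
  by exists (f 0%N) => // k; rewrite leqn0 => /eqP->.
exists (Num.min e (f N.+1)) => [|k]; first by rewrite lt_min e_gt0 f_gt0.
rewrite leq_eqVlt ge_min => /predU1P[->|/eP->//]; by rewrite lexx orbT.
Qed.

(* A sum of [n] unit fractions close to [p > 0] has a term at least [p / (2 n)],
   for which there are finitely many values: remove it and induct on [n]. *)
Lemma egyptian_gap {R : realType} n (p : R) :
  exists2 e : R, 0 < e &
    forall x, egyptian n x -> `|x - p| < e -> p <= x /\ rational p.
Proof.
elim: n p => [|n IHn] p; have [p_lt0|p_gt0|->] := ltgtP p 0.
- exists (- p); rewrite ?oppr_gt0 // => x /egyptian_ge0 x_ge0.
  by rewrite ltr_norml => /andP[_]; lra.
- exists p => // x [s [/size0nil-> ->]]; rewrite big_nil sub0r normrN gtr0_norm //.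
  by rewrite ltxx.
- exists 1; rewrite ?ltr01 // => x /egyptian_ge0 x_ge0 _; split=> //.
  by exists 0; rewrite ?rmorph0.
- exists (- p); rewrite ?oppr_gt0 // => x /egyptian_ge0 x_ge0.
  by rewrite ltr_norml => /andP[_]; lra.
- have [f f_gt0 fP] : exists2 f : nat -> R, (forall k, 0 < f k) &
      forall k x, egyptian n x -> `|x - (p - k%:R^-1)| < f k ->
        p - k%:R^-1 <= x /\ rational (p - k%:R^-1).
    have /choice[f fP] : forall k : nat, exists e : R, 0 < e /\
        forall x, egyptian n x -> `|x - (p - k%:R^-1)| < e ->
        p - k%:R^-1 <= x /\ rational (p - k%:R^-1).
      by move=> k; have [e] := IHn (p - k%:R^-1); exists e.
    by exists f => k; have [] := fP k.
  (* Were all [n + 1] terms below [c], the sum would be at most [p / 2], too far from [p]. *)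
  pose c := p / 2 / n.+1%:R; have c_gt0 : 0 < c by rewrite !divr_gt0 ?ltr0n.
  (* The large term is [1 / k] with [k <= 1 / c], so the gaps [f k] need a common lower bound over
     finitely many [k] only. *)
  have [e e_gt0 eP] := exists_lower_bound (Num.truncn c^-1) f_gt0.
  exists (Num.min e (p / 2)) => [|x [s [sz_s xE]]].
    by rewrite lt_min e_gt0 divr_gt0.
  rewrite lt_min => /andP[lt_e]; rewrite ltr_norml => /andP[lt_p _].
  have [k sk ck] : exists2 k, k \in s & c <= k%:R^-1.
    apply/hasP; apply: contraT => /hasPn ltc.
    have : x <= \sum_(k <- s) c.
      by rewrite xE big_seq [leRHS]big_seq ler_sum // => k /ltc;
        rewrite -ltNge => /ltW.
    rewrite big_const_seq count_predT sz_s iter_addr addr0 -mulr_natr divfK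
      ?pnatr_eq0 //.
    lra.
  have k_gt0 : (0 < k)%N by case: k ck {sk} => //; rewrite invr0 leNgt c_gt0.
  have xE' : x - k%:R^-1 = \sum_(j <- rem k s) j%:R^-1.
    by rewrite xE (perm_big _ (perm_to_rem sk)) big_cons addrC addKr.
  have [||lex ratx] := fP k (x - k%:R^-1).
  - by exists (rem k s); rewrite size_rem // sz_s.
  - rewrite opprB addrA subrK; apply: lt_le_trans lt_e (eP _ _).
    rewrite truncn_ge_nat ?invr_ge0 ?(ltW c_gt0) //.
    by rewrite -[leLHS]invrK lef_pV2 ?posrE ?invr_gt0 ?ltr0n.
  - split; last exact: rationalDr ratx.
    by move: lex; rewrite lerD2r.
- exists 1; rewrite ?ltr01 // => x /egyptian_ge0 x_ge0 _; split=> //.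
  by exists 0; rewrite ?rmorph0.
Qed.

Lemma scaled_egyptian_gap {R : realType} n c (p : R) : (0 < c)%N ->
  exists2 e : R, 0 < e & forall x, egyptian n x -> `|x / c%:R - p| < e ->
    p <= x / c%:R /\ rational p.
Proof.
move=> c_gt0; have cR_gt0 : 0 < c%:R :> R by rewrite ltr0n.
have [e e_gt0 eP] := egyptian_gap n (p * c%:R).
exists (e / c%:R) => [|x nx lt_x]; first by rewrite divr_gt0.
have [|lepx /rational_mulr_nat rp] := eP x nx; last first.
  by rewrite ler_pdivlMr //; split=> //; apply: rp.
rewrite -(ltr_pM2r (x := c%:R^-1)) ?invr_gt0 // -[c%:R^-1]gtr0_norm ?invr_gt0 //.
by rewrite -normrM mulrBl mulfK ?gt_eqF // [`|c%:R^-1|]gtr0_norm ?invr_gt0.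
Qed.

(** * Commuting probabilities *)

Lemma card_comm_pairs (gT : finGroupType) (G : {group gT}) :
  #|comm_pairs G| = comm_in_count G 1%g.
Proof.
rewrite comm_in_countE; apply: eq_card => -[a b]; rewrite !inE /=.
by congr (_ && _); apply/eqP/commgP.
Qed.

Lemma comm_in_count_le (gT : finGroupType) (G : {group gT}) (H : {set gT}) :
  (comm_in_count G H <= #|H| * comm_in_count G 1%g)%N.
Proof.
rewrite comm_in_count1 big_distrr; apply: leq_sum => a Ga.
by rewrite card_comm_in // leq_mul2r subset_leq_card ?orbT ?finset.subsetIl.
Qed.

(** A nonzero count [n] on a pair of cosets divides [|K| ^ 2], so [n / |K| ^ 2] is a unit fraction;
    a count [0] gives the term [0^-1 = 0]. *)
Lemma comm_in_count_egyptian {R : realType} (gT : finGroupType)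
    (G K : {group gT}) :
  normal K G -> exists2 y : R, egyptian (#|G : K|%g ^ 2)%N y &
    (comm_in_count G (K^`(1))%g)%:R / #|G|%:R ^+ 2 = y / (#|G : K|%g ^ 2)%N%:R.
Proof.
move=> nKG; have [s [sz_s dvd_s ->]] := comm_in_count_cosets nKG.
have K0 : #|K|%:R != 0 :> R by rewrite pnatr_eq0 -lt0n cardG_gt0.
exists (\sum_(k <- [seq (#|K| ^ 2 %/ n)%N | n <- s]) k%:R^-1).
  by exists [seq (#|K| ^ 2 %/ n)%N | n <- s]; rewrite size_map.
rewrite -(Lagrange (normal_sub nKG)) natrM exprMn natrX natr_sum invfM mulrA.
congr (_ / _); rewrite big_map mulr_suml; apply: eq_big_seq => n /dvd_s[->|dvd_n].
  by rewrite divn0 mul0r invr0.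
have n_gt0 : (0 < n)%N by apply: dvdn_gt0 dvd_n; rewrite expn_gt0 cardG_gt0.
rewrite -natrX -[X in _ / X%:R](divnK dvd_n) natrM invfM mulrCA divff ?mulr1 //.
by rewrite pnatr_eq0 -lt0n.
Qed.

Lemma comm_probs_approx {R : realType} (e : nat) (d : nat -> nat -> nat) :
  exists M, forall x : R, comm_probs R x -> 1 <= e%:R * x ->
    exists h i, [/\ (0 < h <= M)%N, (0 < i <= M)%N &
      exists2 y, egyptian (i ^ 2)%N y & let q := y / (h * i ^ 2)%N%:R in
        q <= x /\ (d h i)%:R * (x - q) <= 1].
Proof.
have [M0 M0P] := neumann_class2 e.
have [M MP] := exists_equidistributed d M0 M0.
exists M => _ [gT [G ->]]; rewrite /comm_prob card_comm_pairs => leGe.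
have g0 : 0 < #|G|%:R ^+ 2 :> R by rewrite exprn_gt0 // ltr0n cardG_gt0.
have [|K [nK cK iK hK]] := M0P gT G.
  rewrite -comm_in_count1 -(ler_nat R) natrX natrM.
  by rewrite mulrA ler_pdivlMr ?mul1r in leGe.
have [K1 /= [nK1 h1 i1 le1]] := MP gT G K nK cK hK iK.
have [y ey yE] := comm_in_count_egyptian (R := R) nK1.
exists #|(K1^`(1))%g|, #|G : K1|%g; rewrite cardG_gt0 indexg_gt0 h1 i1; split=> //.
exists y => //=; have h0 : 0 < #|(K1^`(1))%g|%:R :> R by rewrite ltr0n cardG_gt0.
have -> : y / (#|(K1^`(1))%g| * #|G : K1|%g ^ 2)%N%:R =
    (comm_in_count G (K1^`(1))%g)%:R / #|G|%:R ^+ 2 / #|(K1^`(1))%g|%:R.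
  by rewrite yE natrM invfM mulrA mulrAC.
split.
  rewrite ler_pdivrMr // mulrAC ler_pM2r ?invr_gt0 // -natrM ler_nat mulnC.
  exact: comm_in_count_le.
move: le1; rewrite -mulnn -(ler_nat R) natrD !natrM -expr2 => le1.
have subE (u v w t : R) : t != 0 -> u / w - v / w / t = (t * u - v) / (t * w).
  by move=> t0; rewrite mulrBl -mulf_div divff // mul1r invfM [t^-1 * _]mulrC mulrA.
rewrite subE ?lt0r_neq0 // -(ler_pM2r (mulr_gt0 h0 g0)) -mulrA divfK.
  by rewrite mul1r mulrBr lerBlDl.
by rewrite lt0r_neq0 // mulr_gt0.
Qed.

(** The finitely many [(h, i)] give a common lower bound for the gaps around [p]. With an error
    [x - q] of at most half the gap, [q] is close enough to [p] to give [p <= q <= x]. *)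
Lemma comm_probs_gap {R : realType} (p : R) : exists2 e : R, 0 < e &
  forall x, comm_probs R x -> `|x - p| < e -> p <= x /\ rational p.
Proof.
have ge0 x : comm_probs R x -> 0 <= x.
  by case=> gT [G ->]; rewrite divr_ge0 ?exprn_ge0 ?ler0n.
have [p_lt0|p_gt0|->] := ltgtP p 0; last 1 first.
- exists 1; rewrite ?ltr01 // => x /ge0 x_ge0 _; split=> //.
  by exists 0; rewrite ?rmorph0.
- exists (- p); rewrite ?oppr_gt0 // => x /ge0 x_ge0.
  by rewrite ltr_norml => /andP[_]; lra.
have /choice[f fP] : forall u : nat * nat, exists e : R, 0 < e /\
    let c := (u.1 * u.2 ^ 2)%N in (0 < c)%N ->
    forall y, egyptian (u.2 ^ 2)%N y -> `|y / c%:R - p| < e ->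
    p <= y / c%:R /\ rational p.
  move=> [h i] /=; have [->|c_gt0] := posnP (h * i ^ 2); first by exists 1.
  by have [e e_gt0 eP] := scaled_egyptian_gap (i ^ 2) p c_gt0; exists e.
(* [d] forces [x - q <= f (h, i) / 2], and [e] ensures [e x >= 1] once [x >= p / 2]. *)
pose d h i := (Num.truncn (2 / f (h, i))).+1.
pose e := (Num.truncn (2 / p)).+1.
have [M MP] := comm_probs_approx (R := R) e d.
have [d0 d0_gt0 d0P] : exists2 d0 : R, 0 < d0 &
    forall h i, (h <= M)%N -> (i <= M)%N -> d0 <= f (h, i).
  have /choice[g gP] : forall h, exists e : R, 0 < e /\
      forall i, (i <= M)%N -> e <= f (h, i).
    move=> h; have [i|e0] := @exists_lower_bound _ (fun i => f (h, i)) M.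
      by have [] := fP (h, i).
    by exists e0.
  have [h|d0 d0_gt0 d0P] := @exists_lower_bound _ g M; first by have [] := gP h.
  by exists d0 => // h i leh lei; apply: le_trans (d0P h leh) _; have [_ ->] := gP h.
exists (Num.min (d0 / 2) (p / 2)) => [|x Px]; first by rewrite lt_min !divr_gt0.
rewrite lt_min => /andP[lt_d]; rewrite ltr_norml => /andP[lt_p _].
have x_gt : p / 2 <= x by lra.
have [|h [i [/andP[h_gt0 leh] /andP[i_gt0 lei] [y ey /= [leqx led]]]]] := MP x Px.
  apply: le_trans (_ : 2 / p * (p / 2) <= _).
    by rewrite mulrA divfK ?gt_eqF // divff.
  by apply: ler_pM => //; rewrite ?divr_ge0 ?(ltW p_gt0) // ltW // truncnS_gt.
have [f_gt0 /= fhi] := fP (h, i); have c_gt0 : (0 < h * i ^ 2)%N.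
  by rewrite muln_gt0 h_gt0 expn_gt0 i_gt0.
set q := y / _ in leqx led.
have leqx2 : x - q <= f (h, i) / 2.
  have d_gt : 2 / f (h, i) < (d h i)%:R by apply: truncnS_gt.
  rewrite -(ler_pM2l (x := 2 / f (h, i))) ?divr_gt0 //.
  rewrite [leRHS](_ : _ = 1); last by rewrite mulrA divfK ?gt_eqF // divff.
  by apply: le_trans led; rewrite ler_wpM2r ?subr_ge0 // ltW.
have [|lepq rp] := fhi c_gt0 y ey.
  rewrite -/q ltr_norml; move: lt_d (d0P h i leh lei); rewrite ltr_norml => /andP[].
  by move=> *; apply/andP; split; lra.
by split=> //; apply: le_trans lepq leqx.
Qed.

Theorem corollary1p3 (R : realType) :
  limit_point (comm_probs R) `<=` @rational R /\
  well_ordered_gt (comm_probs R).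
Proof.
split=> [p lim_p | A sA [a Aa]].
  have [e e_gt0 eP] := comm_probs_gap p.
  have [x [_ Px ex]] := lim_p _ (nbhsx_ballx p e e_gt0).
  by have [|_] := eP x Px; first by rewrite distrC.
have ubA : has_sup A.
  split; first by exists a.
  exists 1 => x /sA[gT [G ->]]; rewrite ler_pdivrMr ?mul1r; last first.
    by rewrite exprn_gt0 // ltr0n cardG_gt0.
  rewrite -natrX ler_nat -mulnn -cardsX; apply: subset_leq_card.
  by apply/fintype.subsetP=> u; rewrite inE => /andP[].
(* A member of [A] close enough to [sup A] is at least [sup A] by the gap, hence is the greatest
   element. *)
have [e e_gt0 eP] := comm_probs_gap (sup A).
have [x Ax ltx] := sup_adherent e_gt0 ubA.
have lex : x <= sup A by apply: sup_upper_bound.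
have [|lesx _] := eP x (sA x Ax).
  by rewrite ltr_norml; apply/andP; split; lra.
exists x; split=> // z Az; apply: le_trans lesx.
exact: sup_upper_bound.
Qed.
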